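(* Let $1\le k<n$, let $\lambda=(\lambda_1,\dots,\lambda_n)$ be a generalized partition, and let $x^{\pm}=(x_1,x_1^{-1},\dots,x_{n-k},x_{n-k}^{-1})$ and $y^{\pm}=(y_1,y_1^{-1},\dots,y_k,y_k^{-1})$. Then the functions ${\rm sp}_{\lambda/\mu}$ satisfy the general branching rule $${\rm sp}_\lambda(x^{\pm};y^{\pm})=\sum_{\mu=(\mu_1,\dots,\mu_{n-k})}{\rm sp}_\mu(x^{\pm})\,{\rm sp}_{\lambda/\mu}(y^{\pm}),$$ where the sum is over all generalized partitions $\mu=(\mu_1,\dots,\mu_{n-k})$.
   Context: A generalized partition $\lambda=(\lambda_1,\dots,\lambda_n)$ is a finite weakly decreasing sequence of nonnegative integers (zeros allowed; the number $n$ of entries is part of the data). For $x^\pm=(x_1,x_1^{-1},\dots,x_N,x_N^{-1})$, $h_m(x^{\pm})$ is defined by $\prod_{i=1}^N\frac{1}{(1-x_iz)(1-x_i^{-1}z)}=\sum_{m\in\mathbb Z}h_m(x^{\pm})z^m$ (so $h_m(x^\pm)=0$ for $m<0$). Symplectic Schur function: for a generalized partition $\lambda=(\lambda_1,\dots,\lambda_N)$ and $N$ variables, $${\rm sp}_\lambda(x^{\pm})=\frac{\det\big(x_i^{\lambda_j+(N-j+1)}-x_i^{-\lambda_j-(N-j+1)}\big)_{i,j=1}^N}{\det\big(x_i^{N-j+1}-x_i^{-(N-j+1)}\big)_{i,j=1}^N};$$ ${\rm sp}_\lambda(x^\pm;y^\pm)$ is this function in the $n$ variables $x_1,\dots,x_{n-k},y_1,\dots,y_k$.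 Skew symplectic Schur function: for generalized partitions $\mu=(\mu_1,\dots,\mu_l)$ and $\lambda=(\lambda_1,\dots,\lambda_{l+N})$ and $x^\pm=(x_1^{\pm1},\dots,x_N^{\pm1})$, ${\rm sp}_{\lambda/\mu}(x^{\pm})=\det(a_{ij})_{1\le i,j\le l+N}$, where (with $\mu_{l+1}=0$) $a_{ij}=h_{\lambda_i-\mu_j-i+j}(x^{\pm})$ for $1\le j\le l+1$ and $a_{ij}=h_{\lambda_i-i+j}(x^{\pm})+h_{\lambda_i-i-j+2l+2}(x^{\pm})$ for $l+2\le j\le l+N$. *)

(* Defs.v *)
From HB Require Import structures.
From mathcomp Require Import all_boot all_order all_algebra.
From mathcomp Require Import boolp classical_sets cardinality fsbigop.
From mathcomp.multinomials Require Import mpoly.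

Set Implicit Arguments.
Unset Strict Implicit.
Unset Printing Implicit Defensive.

Import GRing.Theory.
Local Open Scope ring_scope.

Record gpart (n : nat) :=
  GPart { gpart_val :> n.-tuple nat; _ : sorted geq gpart_val }.
HB.instance Definition _ n := [isSub for @gpart_val n].
HB.instance Definition _ n := [Choice of gpart n by <:].

Section Series.
Variable F : fieldType.

(* The coefficients q_0, ..., q_(m-1) of the formal power series q = 1 / p,
   obtained by solving p * q = 1 degree by degree; meaningful if p`_0 != 0. *)
Fixpoint inv_coefs (p : {poly F}) (m : nat) : seq F :=
  if m is k.+1 then
    let q := inv_coefs p k in
    rcons q ((p`_0)^-1 * ((k == 0%N)%:R - \sum_(i < k) p`_(k - i) * q`_i))
  else [::].

Definition inv_coef (p : {poly F}) (m : nat) : F := (inv_coefs p m.+1)`_m.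

Lemma size_inv_coefs (p : {poly F}) m : size (inv_coefs p m) = m.
Proof. by elim: m => //= m IH; rewrite size_rcons IH. Qed.

Lemma nth_inv_coefs (p : {poly F}) m i : (i < m)%N -> (inv_coefs p m)`_i = inv_coef p i.
Proof.
elim: m => // m IH; rewrite ltnS leq_eqVlt => /orP[/eqP -> //|im].
by rewrite /= nth_rcons size_inv_coefs im IH.
Qed.

Lemma inv_coefP (p : {poly F}) m : p`_0 != 0 ->
  \sum_(i < m.+1) p`_(m - i) * inv_coef p i = (m == 0%N)%:R.
Proof.
move=> p0; rewrite big_ord_recr /= subnn [in X in _ + X]/inv_coef /=.
rewrite nth_rcons size_inv_coefs ltnn eqxx mulVKf //.
under [X in _ - X]eq_bigr => i _ do rewrite nth_inv_coefs //.
by rewrite addrC subrK.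
Qed.

End Series.

Section SymplecticSchur.
Variable F : fieldType.
Implicit Types (x : seq F) (lam mu : seq nat).

Definition genpoly x : {poly F} :=
  \prod_(a <- x) ((1 - a *: 'X) * (1 - a^-1 *: 'X)).

(* h_m(x^{+-}), the coefficient of z^m in 1 / genpoly x. *)
Definition hsym x (m : int) : F :=
  match m with
  | Posz k => inv_coef (genpoly x) k
  | Negz _ => 0
  end.

(* The index j is 0-based, so N - j below is N - j + 1 for j counted from 1. *)
Definition sp_num lam x : F :=
  let N := size x in
  \det (\matrix_(i < N, j < N)
     (x`_i ^+ (nth 0%N lam j + (N - j)) - x`_i ^- (nth 0%N lam j + (N - j)))).

Definition sp_den x : F :=
  let N := size x in
  \det (\matrix_(i < N, j < N) (x`_i ^+ (N - j) - x`_i ^- (N - j))).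

(* Intended for size lam = size x. *)
Definition sp lam x : F := sp_num lam x / sp_den x.

(* Intended for size lam = size mu + size x.  With 0-based i and j, the column
   ranges 1 <= j <= l + 1 and l + 2 <= j become j <= l and l < j, and
   - i - j + 2l + 2 becomes - i - j + 2l.  The default value of nth provides
   the convention mu_(l+1) = 0. *)
Definition skew_sp lam mu x : F :=
  let l := size mu in
  \det (\matrix_(i < size lam, j < size lam)
     (let lami := (nth 0%N lam i)%:Z in
      if (j <= l)%N then hsym x (lami - (nth 0%N mu j)%:Z - i%:Z + j%:Z)
      else hsym x (lami - i%:Z + j%:Z)
         + hsym x (lami - i%:Z - j%:Z + (2 * l)%:Z))).

End SymplecticSchur.

(* The indeterminates x_1, ..., x_l, y_1, ..., y_k, as elements of the field of
   rational functions in l + k variables. *)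
Definition xvars (R : idomainType) (l k : nat) :
    l.-tuple {fraction {mpoly R[l + k]}} :=
  [tuple tofrac 'X_(lshift k i) | i < l].

Definition yvars (R : idomainType) (l k : nat) :
    k.-tuple {fraction {mpoly R[l + k]}} :=
  [tuple tofrac 'X_(rshift l j) | j < k].

(* Main.v *)
Require Import Defs.
From mathcomp Require Import all_boot all_order all_algebra fingroup perm.
From mathcomp Require Import ring zify.
From mathcomp Require Import boolp classical_sets cardinality fsbigop.
From mathcomp.multinomials Require Import mpoly.

(** Write f_m(a) = a^m - a^-m, let P_z be the product of the factors
    (1 - a t)(1 - t/a) over a in z, and let H_z = 1/P_z, so that
    h_(e-m)(z^+-) is the coefficient of t^e in t^m H_z.  Put l = n - k,
    e_i = lam_i + n - i and m_j = mu_j + l - j (indices from 0).  Column j < l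
    of the matrix of sp_(lam/mu)(y) is then read off from t^(k + m_j) H_y at the
    exponents e_i, the next one from t^k H_y and the remaining ones from
    (t^(k-s) + t^(k+s)) H_y, while the numerator of sp_mu(x) is
    det f_(m_j)(x_i).

    The sum over mu is a sum over strictly decreasing sequences m, and a
    variant of the Cauchy-Binet formula ([minor_summation]) collapses it into
    one determinant, whose column j < l now comes from
    (sum over m of f_m(x_j) t^m) t^k H_y, that is, from
    (x_j - 1/x_j) t^(k+1) / ((1 - x_j t)(1 - t/x_j)) times H_y.

    Put z = x ++ y.  Over the common denominator P_z, every column generating
    function becomes G_j H_z with G_j a polynomial which is palindromic about
    t^n and of radius less than n, hence a combination of the n polynomials t^n
    and t^(n-s) + t^(n+s), 0 < s < n.  The collapsed determinant is therefore
    J(lam) C, where J(lam) is the determinant built from these n basic columns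
    and C does not depend on lam.  At lam = 0 the matrix of J is unitriangular,
    which makes C the value of the collapsed determinant at lam = 0
    ([det_palindromic]), namely sp_den x ([det_collapsed_stair]).

    The same argument applies to the numerator of sp_lam(z): as the generating
    function of m |-> f_m(z_j) also has a palindromic numerator over P_z,
    sp_num lam z = J(lam) sp_den z, which is the symplectic Jacobi-Trudi
    identity ([sp_num_JT]).  Eliminating J(lam) between the two gives the
    branching rule multiplied by both denominators
    ([branching_numerators]), and these are nonzero at independent variables
    ([sp_den_neq0]).

    Power series are handled as polynomials modulo t^B, for a bound B above all
    the exponents e_i. *)

Local Open Scope classical_set_scope.
Local Open Scope ring_scope.

Set Implicit Arguments.
Unset Strict Implicit.
Unset Printing Implicit Defensive.

Import GRing.Theory.

(** * Power series modulo 'X^B *)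

Section PowerSeries.
Variable F : fieldType.
Implicit Types (a : F) (p q G : {poly F}) (x y z : seq F) (lam mu : seq nat).

Definition genfactor a : {poly F} := (1 - a *: 'X) * (1 - a^-1 *: 'X).

Lemma genpoly0 x : (genpoly x)`_0 = 1.
Proof.
rewrite -horner_coef0 /genpoly horner_prod big1 // => a _.
by rewrite !hornerE subr0 mulr1.
Qed.

Lemma genfactorE a : a != 0 -> genfactor a = 1 - (a + a^-1) *: 'X + 'X^2.
Proof.
move=> a0; have aV : a%:P * (a^-1)%:P = 1 by rewrite -polyCM divff.
rewrite /genfactor -!mul_polyC polyCD; ring: aV.
Qed.

Lemma dvdXn_coef B p q i : 'X^B %| p - q -> (i < B)%N -> p`_i = q`_i.
Proof.
move=> /dvdpP[r pq] iB; apply/eqP; rewrite -subr_eq0 -coefB pq.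
by rewrite coefMXn iB.
Qed.

Lemma coef0_dvdXn B p : (forall i, (i < B)%N -> p`_i = 0) -> 'X^B %| p.
Proof.
move=> p0; rewrite -(poly_take_drop B p) dvdp_add ?dvdp_mull //.
suff -> : take_poly B p = 0 by rewrite dvdp0.
by apply/polyP => i; rewrite coef_take_poly coef0; case: ifP => // /p0.
Qed.

(** The inverse of [genpoly x], truncated below degree [B]. *)
Definition hpoly B x : {poly F} := \poly_(i < B) inv_coef (genpoly x) i.

Lemma hpolyP B x : 'X^B %| genpoly x * hpoly B x - 1.
Proof.
apply: coef0_dvdXn => i iB; rewrite coefB coef1 mulrC coefM.
apply/eqP; rewrite subr_eq0 -(@inv_coefP _ (genpoly x) i) ?genpoly0 ?oner_eq0 //.
apply/eqP/eq_bigr => j _; rewrite coef_poly mulrC.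
by rewrite (leq_ltn_trans _ iB) // -ltnS.
Qed.

Lemma hpoly0 B x : (0 < B)%N -> (hpoly B x)`_0 = 1.
Proof.
move=> B0; rewrite coef_poly B0 -[LHS]mul1r -[in X in X * _](genpoly0 x).
have:= @inv_coefP _ (genpoly x) 0; rewrite big_ord1 subnn; apply.
by rewrite genpoly0 oner_eq0.
Qed.

Lemma hsym_coef B x i m : (i < B)%N ->
  hsym x (i%:Z - m%:Z) = ('X^m * hpoly B x)`_i.
Proof.
move=> iB; rewrite coefXnM; case: ltnP => im.
  by have -> : i%:Z - m%:Z = Negz (m - i).-1 by lia.
rewrite subzn //= coef_poly (leq_ltn_trans _ iB) // leq_subr //.
Qed.

Definition oddpow (a : F) m : F := a ^+ m - a ^- m.

(** The generating polynomial of the sequence [oddpow a], which vanishes at 0;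
    it is indexed from degree 1 because the exponents [mu_j + l - j] that
    select its coefficients are positive. *)
Definition oddgen B a : {poly F} := \sum_(m < B) oddpow a m.+1 *: 'X^(m.+1).

Lemma oddgenE B a i : (i <= B)%N -> (oddgen B a)`_i = oddpow a i.
Proof.
move=> iB; rewrite coef_sum; under eq_bigr do rewrite coefZ coefXn.
case: i iB => [|i] iB.
  by rewrite big1 ?/oddpow ?expr0 ?invr1 ?subrr // => m _; rewrite mulr0.
rewrite (bigD1 (Ordinal iB)) //= eqxx mulr1 big1 ?addr0 //.
by move=> m; rewrite -val_eqE /= eqSS eq_sym => /negPf ->; rewrite mulr0.
Qed.

(** The sequence [oddpow a] satisfies f_(m+2) = (a + 1/a) f_(m+1) - f_m with
    f_0 = 0 and f_1 = a - 1/a, so its generating function is a multiple of 'X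
    divided by [genfactor a]. *)
Lemma oddgenP B a : a != 0 ->
  'X^B %| oddgen B a * genfactor a - (a - a^-1) *: 'X.
Proof.
move=> a0; apply: coef0_dvdXn => i iB.
rewrite genfactorE // mulrDr mulrBr mulr1 -scalerAr coefB !coefZ coefD coefB.
rewrite coefZ coefMX coefMXn coefX.
case: i iB => [|[|i]] iB; rewrite /= ?subSS ?subn0 ?oddgenE //; try lia.
- by rewrite /oddpow ?expr1 expr0 invr1; field.
- by rewrite /oddpow ?expr1 expr0 invr1; field.
- have : a ^+ i != 0 by rewrite expf_neq0.
  by rewrite /oddpow !exprS; move: (a ^+ i) => b b0; field; rewrite b0 a0.
Qed.

(** * Palindromic polynomials *)

(** The basic palindromes about degree [c]; the columns of a skew symplectic
    Schur function beyond the first [l] come from such polynomials. *)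
Definition symmon c s : {poly F} :=
  if s == 0%N then 'X^c else 'X^(c - s) + 'X^(c + s).

(** [G] is symmetric about degree [c] and supported within distance [r] of
    it.  The bound on the size only limits the upper half: the lower half
    follows by symmetry. *)
Definition palindromic c r G :=
  [/\ (r <= c)%N, (size G <= c + r + 1)%N
    & forall s, (s <= c)%N -> G`_(c - s) = G`_(c + s)].

Lemma palindromic_symmon c s : (s <= c)%N -> palindromic c s (symmon c s).
Proof.
move=> sc; split=> //.
  rewrite /symmon; case: eqP => [->|_]; first by rewrite size_polyXn; lia.
  by apply: leq_trans (size_polyD _ _) _; rewrite !size_polyXn; lia.
move=> t tc; rewrite /symmon; case: eqP => s0.
  by rewrite !coefXn; congr (_%:R); lia.
by rewrite !coefD !coefXn addrC; congr (_%:R + _%:R); lia.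
Qed.

Lemma palindromicZ c r b G : palindromic c r G -> palindromic c r (b *: G).
Proof.
case=> rc sG pG; split=> // [|s sc]; first exact: leq_trans (size_scale_leq _ _) _.
by rewrite !coefZ pG.
Qed.

(** The factor 1 - (a + 1/a) 'X + 'X^2 is itself palindromic, about 1 with
    radius 1. *)
Lemma palindromicM1 c r a G : a != 0 -> palindromic c r G ->
  palindromic c.+1 r.+1 (G * genfactor a).
Proof.
move=> a0 [rc sG pG]; rewrite genfactorE //; set u := a + a^-1.
have big i : (c + r < i)%N -> G`_i = 0.
  by move=> ci; rewrite nth_default // (leq_trans sG) // addn1.
have cE i : (G * (1 - u *: 'X + 'X^2))`_i =
   G`_i - u * (if i is j.+1 then G`_j else 0) + (if i is j.+2 then G`_j else 0).
  rewrite mulrDr mulrBr mulr1 -scalerAr coefD coefB coefZ coefMX coefMXn.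
  by case: i => [|[|i]] //=; rewrite ?subSS ?subn0.
split=> //.
  apply/leq_sizeP => i hi; rewrite cE.
  case: i hi => [|[|i]] hi; rewrite ?big; try lia.
  by rewrite mulr0 subrr addr0.
move=> s sc; rewrite !cE.
have [->|[->|{}sc]] : s = c.+1 \/ s = c \/ (s < c)%N by lia.
- rewrite subnn !addSn !addnS (big (c + c).+2) ?(big (c + c).+1); try lia.
  by rewrite -(pG c) // subnn mulr0; ring.
- rewrite subSnn; case: c {sc} rc sG pG big cE => [|c] rc sG pG big cE.
    by rewrite addn0.
  have := pG c.+1 (leqnn _); have := pG c (leqnSn _).
  rewrite subnn subSnn !addSn !addnS => <- <-.
  by rewrite (big (c + c).+3); [ring|lia].
case: s => [|s] in sc *; first by rewrite addn0 subn0.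
have [d cd] : exists d, c = (d + s).+2 by exists (c - s.+2)%N; lia.
have := pG s.+2 sc; have := pG s.+1 (ltnW sc); have := pG s (ltnW (ltnW sc)).
have -> : (c.+1 - s.+1 = d.+2)%N by lia.
have -> : (c - s = d.+2)%N by lia.
have -> : (c - s.+1 = d.+1)%N by lia.
have -> : (c - s.+2 = d)%N by lia.
by move=> -> -> ->; rewrite addSn !addnS /=; ring.
Qed.

Lemma palindromicM c r G x : 0 \notin x -> palindromic c r G ->
  palindromic (c + size x) (r + size x) (G * genpoly x).
Proof.
move=> + pG; elim: x => [|a x IH].
  by rewrite !addn0 /genpoly big_nil mulr1.
rewrite inE negb_or eq_sym => /andP[a0 /IH{}IH].
rewrite /genpoly big_cons /= !addnS -/(genpoly x).
by rewrite -/(genfactor a) [_ * genpoly x]mulrC mulrA; exact: palindromicM1.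
Qed.

Lemma palindromic_symmonE n r G : (r < n)%N -> palindromic n r G ->
  G = \sum_(s < n) G`_(n + s) *: symmon n s.
Proof.
move=> rn [_ sG pG]; apply/polyP => i; rewrite coef_sum.
have big j : (n + r < j)%N -> G`_j = 0.
  by move=> rj; rewrite nth_default // (leq_trans sG) // addn1.
case: n => [|n] in rn pG big {sG} *; first by [].
have cE (s : 'I_n.+1) : (G`_(n.+1 + s) *: symmon n.+1 s)`_i =
    if (i == n.+1 + s)%N || (i + s == n.+1)%N then G`_(n.+1 + s) else 0.
  rewrite coefZ /symmon; case: s => s sn /=; case: eqP => [->|/eqP s0].
    by rewrite coefXn !addn0 orbb; case: eqP; rewrite ?mulr1 ?mulr0.
  rewrite coefD !coefXn.
  have -> : (i == n.+1 - s)%N = (i + s == n.+1)%N by lia.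
  have [e1|_] := eqVneq i (n.+1 + s)%N; have [e2|_] := eqVneq (i + s)%N n.+1.
  all: rewrite ?eqxx /= ?mulr0n ?mulr1n ?addr0 ?add0r ?mulr1 ?mulr0 //.
  by exfalso; lia.
under eq_bigr do rewrite cE.
have [hi|hi] := boolP ((0 < i < n.+1 + n.+1)%N); last first.
  rewrite big1 => [|[s sn] _ /=]; last by case: ifP => // /orP h; exfalso; lia.
  have [i0|i0] := posnP i; last by apply: big; lia.
  by rewrite i0 -(subnn n.+1) pG //; apply: big; lia.
(* The distance from [i] to the centre of symmetry. *)
have sP : ((if i <= n.+1 then n.+1 - i else i - n.+1) < n.+1)%N by case: ifP; lia.
rewrite (bigD1 (Ordinal sP)) //= big1 ?addr0 => [|[s sn]]; last first.
  rewrite -val_eqE /= => ne; case: ifP => // /orP h.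
  by exfalso; move: ne; case: ifP; lia.
have -> : ((i == n.+1 + (if i <= n.+1 then n.+1 - i else i - n.+1)) ||
   (i + (if i <= n.+1 then n.+1 - i else i - n.+1) == n.+1))%N by case: ifP; lia.
case: leqP => hin; last by congr nth; lia.
by rewrite -pG; [congr nth; lia | lia].
Qed.
End PowerSeries.

(** * Column generating functions and the Jacobi-Trudi identity *)

Section Columns.
Variable F : fieldType.
Implicit Types (a : F) (p q G : {poly F}) (x y z : seq F) (lam mu : seq nat).

(** Column [j] has the power series [G j * H] as generating function and row
    [i] reads its coefficient at the exponent [e i]. *)
Definition coefmx n (e : 'I_n -> nat) (G : 'I_n -> {poly F}) (H : {poly F}) :
    'M_n := \matrix_(i, j) (G j * H)`_(e i).

(** The exponents attached to the zero partition. *)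
Definition stair n (i : 'I_n) : nat := (n - i)%N.

Lemma det_symmon_stair n (H : {poly F}) : H`_0 = 1 ->
  \det (coefmx (@stair n) (fun s => symmon F n s) H) = 1.
Proof.
move=> H0; rewrite -det_tr det_trig.
  rewrite big1 // => i _; rewrite !mxE /symmon /stair; case: i => -[|i] ni /=.
    by rewrite coefXnM subn0 ltnn subnn.
  rewrite mulrDl coefD !coefXnM ltnn subnn H0.
  by case: ifP => [_|]; [rewrite addr0 | lia].
apply/is_trig_mxP => -[i ni] [j nj] /= ij.
rewrite !mxE /symmon /stair /=; case: eqP => [_|_].
  by rewrite coefXnM; case: ifP => //; lia.
rewrite mulrDl coefD !coefXnM.
do 2![case: ifP => [_|]; last by move=> *; exfalso; lia].
by rewrite addr0.
Qed.

(** All the columns lie in the span of the [n] columns given by [symmon n],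
    with coefficients independent of the exponents [e].  The determinant of
    these coefficients is found by taking for [e] the staircase, where the
    basic columns form a unitriangular matrix. *)
Lemma det_palindromic n (e : 'I_n -> nat) (G : 'I_n -> {poly F}) (H : {poly F}) :
  H`_0 = 1 -> (forall j, exists2 r, (r < n)%N & palindromic n r (G j)) ->
  \det (coefmx e G H) =
  \det (coefmx e (fun s => symmon F n s) H) * \det (coefmx (@stair n) G H).
Proof.
move=> H0 palG.
have fact f : coefmx f G H = coefmx f (fun s => symmon F n s) H *m
                             \matrix_(s, j) (G j)`_(n + s).
  apply/matrixP=> i j; rewrite !mxE; have [r rn /(palindromic_symmonE rn) Ge] := palG j.
  rewrite [in LHS]Ge mulr_suml coef_sum; apply: eq_bigr => s _.
  by rewrite !mxE -scalerAl coefZ mulrC.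
by rewrite [in LHS]fact [in RHS](fact (@stair n)) !det_mulmx det_symmon_stair // mul1r.
Qed.

(** The exponents in the numerator of a symplectic Schur function: the entries
    of the partition made strictly decreasing by adding the staircase. *)
Definition shifted n lam (i : 'I_n) : nat := (nth 0%N lam i + (n - i))%N.

(** Passing to the common denominator [genpoly (x ++ y)]: the factor of
    [genpoly x] at [a] cancels against the denominator of [oddgen B a], and the
    other factors of [genpoly x] remain in the numerator. *)
Lemma oddgen_hpoly B k x y a : a \in x -> a != 0 ->
  'X^B %| 'X^k * oddgen B a * hpoly B y -
    ((a - a^-1) *: ('X^(k.+1) * genpoly (rem a x))) * hpoly B (x ++ y).
Proof.
move=> ax a0.
have cat : genpoly (x ++ y) = genfactor a * genpoly (rem a x) * genpoly y.
  by rewrite /genpoly big_cat (big_rem _ ax).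
have := hpolyP B (x ++ y); rewrite cat.
have := hpolyP B y; have := oddgenP B a0; rewrite -!mul_polyC exprSr.
set c := (a - a^-1)%:P; set f := genfactor a; set P := genpoly (rem a x).
set Q := genpoly y; set H := hpoly B y; set K := hpoly B _; set O := oddgen B a.
set Z := 'X^k => h1 h2 h3.
have -> : Z * O * H - c * (Z * 'X * P) * K =
  - (Z * O * H) * (f * P * Q * K - 1) + (Z * O * f * P * K) * (Q * H - 1)
   + Z * P * K * (O * f - c * 'X) by ring.
by rewrite !dvdp_add ?dvdp_mull.
Qed.

Lemma genpoly_hpoly B x y G :
  'X^B %| G * hpoly B y - (G * genpoly x) * hpoly B (x ++ y).
Proof.
have cat : genpoly (x ++ y) = genpoly x * genpoly y by rewrite /genpoly big_cat.
have := hpolyP B (x ++ y); have := hpolyP B y; rewrite cat.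
set P := genpoly x; set Q := genpoly y; set H := hpoly B y; set K := hpoly B _.
move=> h1 h2.
have -> : G * H - (G * P) * K =
  - (G * H) * (P * Q * K - 1) + (G * P * K) * (Q * H - 1) by ring.
by rewrite dvdp_add ?dvdp_mull.
Qed.

Lemma hpoly_nil B G : 'X^B %| G * hpoly B [::] - G.
Proof.
have := @hpolyP F B [::]; rewrite /genpoly big_nil mul1r => h.
by rewrite -[X in _ - X]mulr1 -mulrBr dvdp_mull.
Qed.

Lemma palindromic_oddgen k x a : 0 \notin x -> a \in x ->
  palindromic (size x + k) (size x).-1 ((a - a^-1) *: ('X^(k.+1) * genpoly (rem a x))).
Proof.
move=> x0 ax; apply: palindromicZ.
have := @palindromicM _ k.+1 0 'X^(k.+1) (rem a x).
rewrite size_rem // add0n => /(_ _ _).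
have -> : (k.+1 + (size x).-1 = size x + k)%N by case: x ax {x0} => //= b x _; lia.
apply; first by apply: contra x0 => /mem_rem.
exact: palindromic_symmon.
Qed.

Lemma sp_numE n lam x : size x = n ->
  sp_num lam x = \det (\matrix_(i < n, j < n) oddpow x`_i (shifted lam j)).
Proof. by move=> <-. Qed.

Lemma sp_denE n x : size x = n ->
  sp_den x = \det (\matrix_(i < n, j < n) oddpow x`_i (stair j)).
Proof. by move=> <-. Qed.

(** The symplectic Jacobi-Trudi identity: the determinant on the right is the
    skew symplectic Schur function of [lam] over the empty partition.  It holds because
    the columns of [sp_num] have palindromic numerators over [genpoly z]. *)
Lemma sp_num_JT B n lam z : size z = n -> 0 \notin z ->
  (forall i : 'I_n, shifted lam i < B)%N -> (n < B)%N ->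
  sp_num lam z =
  \det (coefmx (@shifted n lam) (fun s => symmon F n s) (hpoly B z)) * sp_den z.
Proof.
move=> sz z0 lamB nB.
have zP (i : 'I_n) : z`_i \in z by rewrite mem_nth ?sz.
pose G (j : 'I_n) : {poly F} :=
  (z`_j - (z`_j)^-1) *: ('X^1 * genpoly (rem z`_j z)).
have oddE e : (forall i, e i < B)%N ->
    \det (\matrix_(i < n, j < n) oddpow z`_i (e j)) = \det (coefmx e G (hpoly B z)).
  move=> eB; rewrite -det_tr; congr (\det _); apply/matrixP => i j; rewrite !mxE.
  rewrite -(oddgenE _ (ltnW (eB i))) /G -[z in hpoly B z]cats0.
  have zj0 : z`_j != 0 by apply: contraNneq z0 => <-.
  rewrite -(dvdXn_coef (oddgen_hpoly B 0 [::] (zP j) zj0) (eB i)) mul1r.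
  by rewrite (dvdXn_coef (hpoly_nil B _) (eB i)).
rewrite (sp_numE _ sz) (sp_denE sz) !oddE //; last first.
  by move=> i; rewrite (leq_ltn_trans _ nB) ?leq_subr.
apply: det_palindromic => [|j]; first by rewrite hpoly0 // (leq_ltn_trans _ nB).
exists n.-1; first by case: n j {sz lamB nB zP G oddE} => [[]|].
by rewrite -[X in palindromic X _]addn0 -sz; apply: palindromic_oddgen.
Qed.
End Columns.

(** * A Cauchy-Binet formula *)

Section MinorSummation.
Variables (l B : nat).
Implicit Types (f g : {ffun 'I_l -> 'I_B}).

Definition strict_decr f :=
  [forall i : 'I_l, forall j : 'I_l, (i < j)%N ==> (f j < f i)%N].

Lemma strict_decrP f : reflect {homo f : i j / (i < j)%N >-> (j < i)%N} (strict_decr f).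
Proof.
apply: (iffP forallP) => [h i j ij|h i].
  by have /forallP/(_ j)/implyP := h i; apply.
by apply/forallP => j; apply/implyP; apply: h.
Qed.

Lemma strict_decr_lt f i j : strict_decr f -> (f j < f i)%N = (i < j)%N.
Proof.
move/strict_decrP => h; case: (ltngtP i j) => [/h -> //|/h ji|/val_inj ->].
  by rewrite ltnNge (ltnW ji).
by rewrite ltnn.
Qed.

Lemma rank_ltn f i : (#|[pred j | (f i < f j)%N]| < l)%N.
Proof.
rewrite -[X in (_ < X)%N]card_ord; apply: proper_card.
apply/fintype.properP; split; first exact/fintype.subsetP.
by exists i; rewrite // inE ltnn.
Qed.

(** The number of larger values: for an injective [f] this is the permutation
    that sorts [f] in decreasing order. *)
Definition rank f i : 'I_l := Ordinal (rank_ltn f i).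

Lemma rank_le f i j : (f i <= f j)%N -> (rank f j <= rank f i)%N.
Proof.
move=> ij; apply: subset_leq_card.
by apply/fintype.subsetP => t /(leq_ltn_trans ij).
Qed.

Lemma rank_lt f i j : (f i < f j)%N -> (rank f j < rank f i)%N.
Proof.
move=> ij; apply: proper_card; apply/fintype.properP; split.
  by apply/fintype.subsetP => t; apply/ltn_trans.
by exists j; rewrite ?inE // ltnn.
Qed.

Lemma rank_inj f : injective f -> injective (rank f).
Proof.
move=> fI i j /(congr1 val) /= rij; apply: fI; apply: val_inj.
by case: (ltngtP (f i) (f j)) => // /rank_lt /=; rewrite rij ltnn.
Qed.

Lemma rank_strict_decr g (s : 'S_l) i : strict_decr g -> rank [ffun j => g (s j)] i = s i.
Proof.
move=> gd; apply: val_inj => /=.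
transitivity (\sum_(t < l | (t < s i)%N) 1)%N.
  rewrite -sum1_card [RHS](reindex_inj (@perm_inj _ s)); apply: eq_bigl => j.
  by rewrite !inE !ffunE strict_decr_lt.
by rewrite -(big_ord_widen l (fun=> 1%N)) ?sum1_card ?card_ord // ltnW.
Qed.

Lemma strict_decr_unrank f (fI : injective f) :
  strict_decr [ffun j => f ((perm (rank_inj fI))^-1%g j)].
Proof.
apply/strict_decrP => i j; rewrite !ffunE; set s := perm _ => ij.
rewrite ltnNge; apply/negP => /rank_le.
by rewrite -!(permE (rank_inj fI)) -/s !permKV leqNgt ij.
Qed.

(** An injective map is uniquely a strictly decreasing one composed with a
    permutation, which is the map [rank]. *)
Lemma sum_injective (R : zmodType) (G : {ffun 'I_l -> 'I_B} -> R) :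
  \sum_(f : {ffun 'I_l -> 'I_B} | injectiveb f) G f =
  \sum_(g | strict_decr g) \sum_(s : 'S_l) G [ffun j => g (s j)].
Proof.
rewrite pair_big_dep /=.
pose h (u : {ffun 'I_l -> 'I_B} * 'S_l) := [ffun j => u.1 (u.2 j)].
(* The inverse of [h] on injective maps: sort the values and keep the sorting
   permutation. *)
pose h' f := if @injectiveP _ _ f is ReflectT fI
  then let s := perm (rank_inj fI) in ([ffun j => f (s^-1 j)%g], s) else (f, 1%g).
rewrite (reindex_omap h (fun f => Some (h' f))) /=; last first.
  move=> f /injectiveP inj; rewrite /h'; case: injectiveP => // fI; congr Some.
  by apply/ffunP => j; rewrite /h !ffunE permK.
apply: eq_bigl => -[g s] /=.
rewrite andbT.
apply/andP/idP => [[fI /eqP[]]|gd].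
  rewrite /h'; case: injectiveP => [{}fI [eg _]|]; last by move/injectiveP: fI.
  by have := strict_decr_unrank fI; rewrite eg.
have hI : injective (h (g, s)).
  move=> i j; rewrite /h !ffunE /= => gij; apply: (@perm_inj _ s); apply: val_inj.
  by case: (ltngtP (s i) (s j)) => //; rewrite -(strict_decr_lt _ _ gd) gij ltnn.
split; first exact/injectiveP.
rewrite /h'; case: injectiveP => // fI; apply/eqP.
have -> : perm (rank_inj fI) = s by apply/permP => i; rewrite permE rank_strict_decr.
by congr (Some (_, _)); apply/ffunP => j; rewrite !ffunE /= permKV.
Qed.

Variables (R : comNzRingType) (k : nat).
Variables (V : 'M[R]_(l + k, B)) (W : 'M[R]_(l + k, k)) (F : 'M[R]_(l, B)).

Lemma det_row_mx_expand :
  \det (row_mx (V *m F^T) W) =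
  \sum_(f : {ffun 'I_l -> 'I_B}) (\prod_j F j (f j)) * \det (row_mx (colsub f V) W).
Proof.
rewrite -det_tr [in LHS]/determinant.
(* Both sides are expanded by the Leibniz formula for the transposed
   matrices; the first [l] factors of each term then distribute over [f]. *)
transitivity (\sum_(s : 'S_(l + k)) \sum_(f : {ffun 'I_l -> 'I_B}) (-1) ^+ s *
   ((\prod_j F j (f j)) * ((\prod_j V (s (lshift k j)) (f j)) *
     \prod_j W (s (rshift l j)) j))).
  apply: eq_bigr => s _; rewrite big_split_ord /= -big_distrr /=; congr (_ * _).
  have -> : \prod_i (row_mx (V *m F^T) W)^T (lshift k i) (s (lshift k i)) =
            \sum_(f : {ffun 'I_l -> 'I_B})
              ((\prod_j F j (f j)) * (\prod_j V (s (lshift k j)) (f j))).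
    under eq_bigr do rewrite mxE row_mxEl mxE.
    rewrite bigA_distr_bigA; apply: eq_bigr => f _.
    by rewrite -big_split; apply: eq_bigr => i _; rewrite mxE mulrC.
  rewrite big_distrl; apply: eq_bigr => f _ /=; rewrite mulrA; congr (_ * _).
  by apply: eq_bigr => i _; rewrite mxE row_mxEr.
rewrite exchange_big; apply: eq_bigr => f _ /=.
rewrite -det_tr /determinant big_distrr; apply: eq_bigr => s _ /=.
rewrite mulrCA big_split_ord /=; congr (_ * (_ * (_ * _))).
  by apply: eq_bigr => i _; rewrite mxE row_mxEl mxE.
by apply: eq_bigr => i _; rewrite mxE row_mxEr.
Qed.

Lemma det_colsub_noninj f : ~~ injectiveb f -> \det (row_mx (colsub f V) W) = 0.
Proof.
move=> /injectivePn[i [j ij fij]]; rewrite -det_tr.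
apply: (@determinant_alternate _ _ _ (lshift k i) (lshift k j)).
  by rewrite (inj_eq (@lshift_inj _ _)).
by move=> t; rewrite mxE [RHS]mxE !row_mxEl !mxE fij.
Qed.

Lemma det_colsub_perm g (s : 'S_l) :
  \det (row_mx (colsub [ffun j => g (s j)] V) W) =
  (-1) ^+ s * \det (row_mx (colsub g V) W).
Proof.
have -> : row_mx (colsub [ffun j => g (s j)] V) W =
    row_mx (colsub g V) W *m block_mx (perm_mx s^-1) 0 0 1%:M.
  rewrite mul_row_block !mulmx0 mulmx1 add0r addr0 -col_permE; congr row_mx.
  by apply/matrixP => i j; rewrite !mxE ffunE.
by rewrite det_mulmx det_ublock det_perm det1 mulr1 mulrC odd_permV.
Qed.

(** Only the first [l] columns are expanded.  When [k = 0] this is the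
    Cauchy-Binet formula for [V *m F^T]; in general, as there, the expansion of
    the right-hand side runs over all maps choosing columns of [V], the
    non-injective ones vanish, and the sum over the rearrangements of a
    decreasing map rebuilds the minor of [F]. *)
Lemma minor_summation :
  \sum_(g | strict_decr g) \det (colsub g F) * \det (row_mx (colsub g V) W) =
  \det (row_mx (V *m F^T) W).
Proof.
rewrite det_row_mx_expand.
rewrite [RHS](bigID (fun f : {ffun 'I_l -> 'I_B} => injectiveb f)) /=.
rewrite [X in _ + X]big1 ?addr0; last first.
  by move=> f fN; rewrite det_colsub_noninj ?mulr0.
rewrite sum_injective; apply: eq_bigr => g _; rewrite big_distrl /=.
apply: eq_bigr => s _; rewrite det_colsub_perm mulrA; congr (_ * _); rewrite mulrC.
by congr (_ * _); apply: eq_bigr => i _; rewrite !mxE ffunE.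
Qed.
End MinorSummation.

(** * The collapsed determinant *)

Section Branching.
Variable F : fieldType.
Implicit Types (a : F) (p q G : {poly F}) (x y z : seq F) (lam mu : seq nat).

Lemma skew_spE B l k lam mu y : size lam = (l + k)%N -> size mu = l ->
  (forall i : 'I_(l + k), shifted lam i < B)%N ->
  skew_sp lam mu y =
  \det (coefmx (@shifted (l + k) lam)
         (fun j => match split j with
                   | inl j => 'X^(k + shifted mu j)
                   | inr j => symmon F k j
                   end) (hpoly B y)).
Proof.
move=> slam smu; rewrite /skew_sp slam smu => lamB.
congr (\det _); apply/matrixP => i j; rewrite !mxE.
have := ltn_ord i; have := lamB i; rewrite /shifted; move: (val i) => {lamB}i iB iln.
set b := nth _ _ _ in iB *; case: splitP => [[j' jl] /= ->|[j' jk] /= ->].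
  rewrite ltnW // -(hsym_coef _ _ iB); congr hsym.
  by lia.
rewrite /symmon; case: eqP => [->|j0].
  rewrite addn0 leqnn nth_default ?smu // -(hsym_coef _ _ iB); congr hsym.
  by lia.
rewrite leqNgt ltnNge mulrDl coefD -!(hsym_coef _ _ iB).
have -> : (l + j' <= l)%N = false by lia.
by congr (hsym _ _ + hsym _ _); lia.
Qed.

(** For such [mu] a whole column of the defining determinant consists of
    h_m with m < 0; this is what makes the branching sum finite. *)
Lemma skew_sp_eq0 B l k lam mu y (j : 'I_l) : size lam = (l + k)%N -> size mu = l ->
  (forall i : 'I_(l + k), shifted lam i < B)%N -> (B < shifted mu j)%N ->
  skew_sp lam mu y = 0.
Proof.
move=> slam smu lamB muB; rewrite (skew_spE y slam smu lamB).
rewrite (expand_det_col _ (lshift k j)) big1 // => i _.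
rewrite mxE (unsplitK (inl _ j)) coefXnM ifT ?mul0r //.
by rewrite (leq_trans (lamB i)) // (leq_trans (ltnW muB)) ?leq_addl.
Qed.

Section Determinant.
Variables (B l k : nat) (x y : seq F).
Hypotheses (sx : size x = l) (x0 : 0 \notin x).
Hypothesis lkB : (l + k < B)%N.

(** Minors of [powmx] are numerators of symplectic Schur functions of [x], and
    the minors of [hmx e] completed by [tailmx e] are skew symplectic Schur
    functions of [y] when [e] lists the exponents of a partition.  The column
    [m] stands for the exponent [m.+1]. *)
Definition powmx : 'M[F]_(l, B) := \matrix_(i, m) oddpow x`_i m.+1.
Definition hmx (e : 'I_(l + k) -> nat) : 'M[F]_(l + k, B) :=
  \matrix_(i, m) ('X^(k + m.+1) * hpoly B y)`_(e i).
Definition tailmx (e : 'I_(l + k) -> nat) : 'M[F]_(l + k, k) :=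
  \matrix_(i, s) (symmon F k s * hpoly B y)`_(e i).

Lemma hmx_powmxE e i j :
  (hmx e *m powmx^T) i j = ('X^k * oddgen B x`_j * hpoly B y)`_(e i).
Proof.
rewrite mxE /oddgen mulr_sumr mulr_suml coef_sum; apply: eq_bigr => m _.
by rewrite !mxE -scalerAr -scalerAl coefZ exprD mulrC.
Qed.

(** For the zero partition the exponents of the last [k] rows are at most [k],
    too small for ['X^k * oddgen], so the matrix is block triangular.  Its
    lower right block is unitriangular, and the upper left one is a unitriangular
    matrix times the transpose of the one defining [sp_den x]. *)
Lemma det_collapsed_stair :
  \det (row_mx (hmx (@stair _) *m powmx^T) (tailmx (@stair _))) = sp_den x.
Proof.
have B0 : (0 < B)%N by rewrite (leq_ltn_trans _ lkB).
rewrite -[X in row_mx X _]vsubmxK -[X in row_mx _ X]vsubmxK -block_mxEh.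
set T := usubmx _; set Z := dsubmx _; set D := dsubmx (tailmx _).
have -> : Z = 0.
  apply/matrixP => i j; rewrite mxE hmx_powmxE /stair /= mxE -mulrA coefXnM.
  case: ltnP => // ki; have -> : (l + k - (l + i) - k = 0)%N by lia.
  by rewrite coef0M oddgenE // /oddpow expr0 invr1 subrr mul0r.
rewrite det_ublock; have -> : D = coefmx (@stair k) (fun s => symmon F k s) (hpoly B y).
  by apply/matrixP => i j; rewrite !mxE /stair /= subnDl.
rewrite det_symmon_stair ?hpoly0 // mulr1 (sp_denE sx).
have -> : T = coefmx (@stair l) (fun t => 'X^(l - t)) (hpoly B y) *m
    (\matrix_(i < l, j < l) oddpow x`_i (stair j))^T.
  apply/matrixP => i j; rewrite mxE hmx_powmxE /stair /= mxE -mulrA coefXnM.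
  have il := ltn_ord i; case: ltnP => [|_]; first by lia.
  have -> : (l + k - i - k = l - i)%N by lia.
  have -> : (oddgen B x`_j * hpoly B y)`_(l - i) =
            (oddgen l x`_j * hpoly B y)`_(l - i).
    rewrite !coefM; apply: eq_bigr => s _; have := ltn_ord s => si.
    by rewrite !oddgenE //; lia.
  rewrite /oddgen mulr_suml coef_sum (reindex_inj rev_ord_inj) /=.
  apply: eq_bigr => t _; rewrite !mxE -scalerAl coefZ mulrC.
  by have -> : (l - t.+1).+1 = (l - t)%N by have := ltn_ord t; lia.
rewrite det_mulmx det_tr -[X in X * _]det_tr det_trig; last first.
  apply/is_trig_mxP => -[i il] [j jl] /= ij; rewrite !mxE /stair /= coefXnM.
  by case: ifP => //; lia.
rewrite big1 ?mul1r // => i _; rewrite !mxE coefXnM /stair ltnn subnn hpoly0 //.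
Qed.

(** Over the denominator [genpoly (x ++ y)] the columns get numerators
    palindromic about [l + k], of radius [l - 1] for the first [l] columns and
    [s + l], with [s < k], for the others. *)
Lemma det_collapsed e : (forall i, e i < B)%N ->
  \det (row_mx (hmx e *m powmx^T) (tailmx e)) =
  \det (coefmx e (fun s => symmon F (l + k) s) (hpoly B (x ++ y))) * sp_den x.
Proof.
pose G (j : 'I_(l + k)) : {poly F} := match split j with
  | inl j => (x`_j - (x`_j)^-1) *: ('X^(k.+1) * genpoly (rem x`_j x))
  | inr j => symmon F k j * genpoly x end.
have GE f : (forall i, f i < B)%N ->
    row_mx (hmx f *m powmx^T) (tailmx f) = coefmx f G (hpoly B (x ++ y)).
  move=> fB; apply/matrixP => i j; rewrite !mxE /G; case: (split j) => {}j.
    have jx : x`_j \in x by rewrite mem_nth ?sx.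
    have j0 : x`_j != 0 by apply: contraNneq x0 => <-.
    by rewrite hmx_powmxE (dvdXn_coef (oddgen_hpoly B k y jx j0) (fB i)).
  by rewrite mxE (dvdXn_coef (genpoly_hpoly B x y _) (fB i)).
move=> eB; have H0 : (hpoly B (x ++ y))`_0 = 1.
  by rewrite hpoly0 // (leq_ltn_trans _ lkB).
have sB (i : 'I_(l + k)) : (stair i < B)%N by rewrite (leq_ltn_trans _ lkB) ?leq_subr.
rewrite -det_collapsed_stair !GE //; apply: det_palindromic => // j.
rewrite /G; case: splitP => j' jE.
  exists l.-1; first by have := ltn_ord j'; lia.
  have jx : x`_j' \in x by rewrite mem_nth ?sx.
  by have := palindromic_oddgen k x0 jx; rewrite sx.
exists (j' + l)%N; first by have := ltn_ord j'; lia.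
rewrite addnC; have := @palindromicM _ k j' (symmon F k j') x; rewrite sx.
by apply=> //; apply: palindromic_symmon; rewrite ltnW.
Qed.
End Determinant.

(** * Partitions and strictly decreasing maps *)

Section Partitions.
Variables (l B : nat).
Implicit Types (g : {ffun 'I_l -> 'I_B}).

Lemma sorted_nseq0 : sorted geq (nseq_tuple l 0%N).
Proof. by apply/(sortedP 0%N) => i _; rewrite !nth_nseq !if_same. Qed.

(** The inverse of adding the staircase to a partition.  The difference is
    sorted when [g] is strictly decreasing, and [insubd] checks that it is. *)
Definition gpart_of g : gpart l :=
  insubd (GPart sorted_nseq0) [tuple (g j - (l - j.+1))%N | j < l].

Lemma nth_gpart_of g (j : 'I_l) : strict_decr g ->
  nth 0%N (gpart_of g) j = (g j - (l - j.+1))%N.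
Proof.
move=> /strict_decrP gd; rewrite /gpart_of insubdK; first by rewrite (nth_mktuple _ 0%N).
rewrite unfold_in; apply/(sortedP 0%N) => i; rewrite size_tuple => il.
have nthE t (tl : (t < l)%N) : nth 0%N [tuple (g j - (l - j.+1))%N | j < l] t =
   (g (Ordinal tl) - (l - t.+1))%N :=
   nth_mktuple (fun j => (g j - (l - j.+1))%N) 0%N (Ordinal tl).
rewrite (nthE _ il) (nthE _ (ltnW il)).
have := gd (Ordinal (ltnW il)) (Ordinal il) (ltnSn _).
by rewrite /geq /=; lia.
Qed.

Lemma strict_decr_ge g (j : 'I_l) : strict_decr g -> (l - j.+1 <= g j)%N.
Proof.
move=> /strict_decrP gd; move dE : (l - j.+1)%N => d; elim: d j dE => // d IH j dE.
have jl : (j.+1 < l)%N by lia.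
have /= := IH (Ordinal jl); have := gd j (Ordinal jl) (ltnSn _) => /= h1 h2.
by apply: leq_trans h1; rewrite ltnS; apply: h2; lia.
Qed.

Lemma shifted_gpart_of g (j : 'I_l) : strict_decr g -> shifted (gpart_of g) j = (g j).+1.
Proof.
move=> gd; rewrite /shifted nth_gpart_of //.
by have := strict_decr_ge j gd; have := ltn_ord j; lia.
Qed.

Lemma gpart_of_inj : {in [pred g | strict_decr g] &, injective gpart_of}.
Proof.
move=> g h; rewrite !inE => gd hd gh; apply/ffunP => j; apply/val_inj/eqP.
by rewrite -eqSS -!shifted_gpart_of // gh.
Qed.

Definition gparts : seq (gpart l) :=
  [seq gpart_of g | g <- enum [pred g : {ffun 'I_l -> 'I_B} | strict_decr g]].

Lemma uniq_gparts : uniq gparts.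
Proof.
rewrite map_inj_in_uniq ?enum_uniq // => g h; rewrite !mem_enum.
exact: gpart_of_inj.
Qed.

Lemma gpartP (mu : gpart l) i j : (i <= j)%N -> (nth 0%N mu j <= nth 0%N mu i)%N.
Proof.
move=> ij; case: (ltnP j l) => jl; last by rewrite nth_default ?size_tuple.
have h : sorted geq mu := valP mu.
apply: (sorted_leq_nth _ _ _ h) => //; rewrite ?inE ?size_tuple //.
- by move=> a b c /= ba cb; apply: leq_trans cb ba.
- by move=> a /=.
- exact: leq_ltn_trans ij jl.
Qed.

Lemma mem_gparts (mu : gpart l) :
  (forall j : 'I_l, shifted mu j <= B)%N -> mu \in gparts.
Proof.
move=> muB.
have mB (j : 'I_l) : (nth 0%N mu j + (l - j.+1) < B)%N.
  by have := muB j; rewrite /shifted; have := ltn_ord j; lia.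
pose g := [ffun j => Ordinal (mB j)].
have gd : strict_decr g.
  apply/strict_decrP => i j ij; rewrite !ffunE /=.
  by have := gpartP mu (ltnW ij); have := ltn_ord j; lia.
apply/mapP; exists g; first by rewrite mem_enum.
apply/val_inj/val_inj/(@eq_from_nth _ 0%N); rewrite !size_tuple // => i il.
rewrite -[i]/(val (Ordinal il)) nth_gpart_of // ffunE /=; lia.
Qed.

Lemma big_gparts (R : nmodType) (f : gpart l -> R) :
  \sum_(mu <- gparts) f mu = \sum_(g : {ffun 'I_l -> 'I_B} | strict_decr g) f (gpart_of g).
Proof. by rewrite big_map big_enum. Qed.
End Partitions.

(** * The branching rule *)

(** Both sides equal the Jacobi-Trudi determinant of [lam] at [x ++ y] times
    [sp_den x * sp_den (x ++ y)]. *)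
Lemma branching_numerators B l k lam x y : size x = l -> size y = k ->
  size lam = (l + k)%N -> 0 \notin x ++ y -> (l + k < B)%N ->
  (forall i : 'I_(l + k), shifted lam i < B)%N ->
  (\sum_(mu <- gparts l B) sp_num mu x * skew_sp lam mu y) * sp_den (x ++ y) =
  sp_num lam (x ++ y) * sp_den x.
Proof.
move=> sx sy slam xy0 lkB lamB.
have x0 : 0 \notin x by apply: contra xy0; rewrite mem_cat => ->.
rewrite (@sp_num_JT _ B (l + k)) ?size_cat ?sx ?sy // mulrAC; congr (_ * _).
rewrite -(det_collapsed y sx x0 lkB lamB) -minor_summation big_gparts.
apply: eq_bigr => g gd; rewrite (sp_numE _ sx); congr (_ * _).
  by congr (\det _); apply/matrixP => i j; rewrite !mxE shifted_gpart_of.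
rewrite (skew_spE _ slam _ lamB) ?size_tuple //; congr (\det _).
apply/matrixP => i j; rewrite !mxE; case: (split j) => {}j; rewrite !mxE //.
by rewrite shifted_gpart_of.
Qed.
End Branching.

(** A linear relation [v] between the columns is an odd Laurent polynomial of
    degree at most [n] vanishing at each [x_i], hence also at [x_i^-1] and at
    1.  Multiplied by 'X^n it is a nonzero polynomial of degree at most [2n]
    with [2n + 1] distinct roots.  This is valid in every characteristic,
    including 2. *)
Lemma sp_den_neq0 (F : fieldType) (x : seq F) :
  0 \notin x -> uniq (1 :: x ++ [seq a^-1 | a <- x]) -> sp_den x != 0.
Proof.
move=> x0 ux; rewrite (sp_denE (erefl _)); set n := size x.
rewrite -det_tr; apply/negP => /det0P[v v0 vA].
pose p : {poly F} := \sum_(j < n) v 0 j *: ('X^(n + (n - j)) - 'X^j).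
have pE a : a != 0 -> p.[a] = a ^+ n * \sum_(j < n) v 0 j * oddpow a (n - j).
  move=> a0; rewrite horner_sum mulr_sumr; apply: eq_bigr => j _.
  rewrite mulrCA hornerZ hornerD hornerN !hornerXn; congr (_ * _).
  rewrite /oddpow mulrBr -exprD; congr (_ - _).
  by rewrite -expfB_cond ?(negPf a0) ?add0n ?leq_subr // subKn // ltnW.
have rx a : a \in x -> \sum_(j < n) v 0 j * oddpow a (n - j) = 0.
  move=> /(nthP 0)[i ix <-]; have /rowP/(_ (Ordinal ix)) := vA.
  by rewrite !mxE => e; rewrite -[RHS]e; apply: eq_bigr => j _; rewrite !mxE.
have p0 : p != 0.
  have /rV0Pn[j vj] := v0; apply: contraNneq vj => pn0.
  have <- : p`_(n + (n - j)) = v 0 j; last by rewrite pn0 coef0.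
  rewrite coef_sum (bigD1 j) //= big1 => [|t tj].
    rewrite coefZ coefB !coefXn eqxx; have := ltn_ord j => jn.
    by case: eqP => [|_]; [lia | rewrite subr0 mulr1 addr0].
  rewrite coefZ coefB !coefXn; have := ltn_ord j; have := ltn_ord t => tn jn.
  move: tj; rewrite -val_eqE /= => tj.
  case: eqP => [|_]; first by move: tj; lia.
  by case: eqP => [|_]; [lia | rewrite subr0 mulr0].
have sp : (size p <= (n + n).+1)%N.
  apply/leq_sizeP => i ni; rewrite coef_sum big1 // => j _.
  rewrite coefZ coefB !coefXn; have := ltn_ord j => jn.
  by do 2![case: eqP => [|_]; first by lia]; rewrite subr0 mulr0.
have := max_poly_roots p0 _ ux.
rewrite /= size_cat size_map -/n ltnNge sp => H; apply/negP: isT; apply: H.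
rewrite rootE pE ?oner_eq0 // big1 ?mulr0 ?eqxx /=; last first.
  by move=> j _; rewrite /oddpow !expr1n invr1 subrr mulr0.
have ne0 a : a \in x -> a != 0 by move=> ax; apply: contraNneq x0 => <-.
rewrite all_cat; apply/andP; split; apply/allP => a.
  by move=> ax; rewrite rootE pE ?ne0 // rx ?mulr0.
case/mapP => b bx ->; rewrite rootE pE ?invr_eq0 ?ne0 // -[X in _ * X]opprK -sumrN.
have -> : \sum_(j < n) - (v 0 j * oddpow b^-1 (n - j)) = 0.
  rewrite -[RHS](rx b bx); apply: eq_bigr => j _.
  by rewrite /oddpow !exprVn invrK -mulrN opprB.
by rewrite oppr0 mulr0.
Qed.

(** * Independent variables *)

Section Variables.
Variables (R : idomainType) (m : nat).

Definition varf (i : 'I_m) : {fraction {mpoly R[m]}} := tofrac 'X_i.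

Let ev (v : 'I_m -> R) (p q : {mpoly R[m]}) : tofrac p = tofrac q -> p.@[v] = q.@[v].
Proof. by move=> /eqP; rewrite tofrac_eq => /eqP ->. Qed.

Lemma varf_inj : injective varf.
Proof.
move=> i j /(@ev (fun t => (t == i)%:R)); rewrite !mevalXU eqxx.
by case: eqP => // _ /eqP; rewrite oner_eq0.
Qed.

Lemma varf_neq1 i : varf i != 1.
Proof.
apply/eqP; rewrite -tofrac1 => /(@ev (fun t => 0)); rewrite mevalXU meval1.
by move=> /esym/eqP; rewrite oner_eq0.
Qed.

Lemma varfM_neq1 i j : varf i * varf j != 1.
Proof.
apply/eqP; rewrite -tofracM -tofrac1 => /(@ev (fun t => 0)).
by rewrite mevalM !mevalXU meval1 mulr0 => /esym/eqP; rewrite oner_eq0.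
Qed.

Lemma varf_neq0 i : varf i != 0.
Proof.
apply/eqP; rewrite -tofrac0 => /(@ev (fun t => 1)); rewrite mevalXU meval0.
by move=> /eqP; rewrite oner_eq0.
Qed.

Lemma varf_notin0 (s : seq 'I_m) : 0 \notin map varf s.
Proof. by apply/mapP => -[i _ /esym/eqP]; apply/negP/varf_neq0. Qed.

Lemma sp_den_varf (s : seq 'I_m) : uniq s -> sp_den (map varf s) != 0.
Proof.
move=> us; apply: sp_den_neq0; first exact: varf_notin0.
rewrite -map_comp /= mem_cat cat_uniq !map_inj_uniq ?us //=; last 2 first.
- by move=> i j /= /invr_inj /varf_inj.
- exact: varf_inj.
rewrite andbT; apply/andP; split.
  rewrite negb_or; apply/andP; split; apply/mapP => -[i _ /= e].
    by have := varf_neq1 i; rewrite -e eqxx.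
  by have := varf_neq1 i; rewrite -[varf i]invrK -e invr1 eqxx.
apply/hasPn => _ /mapP[i _ ->]; apply/mapP => -[j _ /= e].
by have := varfM_neq1 i j; rewrite -e divff ?eqxx ?varf_neq0.
Qed.
End Variables.

Unset Implicit Arguments.

Theorem proposition3p4 (R : idomainType) (n k : nat) (hk : (1 <= k < n)%N)
    (lam : gpart n) :
  let x := xvars R (n - k) k in
  let y := yvars R (n - k) k in
  finite_set [set mu : gpart (n - k) | sp mu x * skew_sp lam mu y <> 0] /\
  sp lam (x ++ y) =
    \sum_(mu \in [set: gpart (n - k)]) sp mu x * skew_sp lam mu y.
Proof.
set l := (n - k)%N => x y.
have nE : n = (l + k)%N by rewrite subnK // ltnW; case/andP: hk.
have slam : size lam = (l + k)%N by rewrite size_tuple.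
pose sx : seq 'I_(l + k) := map (lshift k) (enum 'I_l).
pose sy : seq 'I_(l + k) := map (@rshift l k) (enum 'I_k).
have xE : x = map (@varf R (l + k)) sx :> seq _ by rewrite -map_comp.
have xyE : x ++ y = map (@varf R (l + k)) (sx ++ sy) :> seq _.
  by rewrite map_cat -xE -map_comp.
have usx : uniq sx by rewrite map_inj_uniq ?enum_uniq //; exact: lshift_inj.
have uxy : uniq (sx ++ sy).
  rewrite cat_uniq usx map_inj_uniq ?enum_uniq ?andbT; last exact: rshift_inj.
  apply/hasPn => _ /mapP[i _ ->]; apply/mapP => -[j _ /(congr1 val) /=].
  by have := ltn_ord j; lia.
(* Exceeds all the exponents [lam_i + n - i], as each [lam_i] is at most the
   sum of [lam]. *)
pose B := (sumn lam + (l + k)).+1.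
have lkB : (l + k < B)%N by rewrite ltnS leq_addl.
have lamB (i : 'I_(l + k)) : (shifted lam i < B)%N.
  rewrite ltnS leq_add ?leq_subr // sumnE (big_nth 0%N) big_mkord.
  by rewrite slam (bigD1 i) //= leq_addr.
have supp mu : mu \notin gparts l B -> sp mu x * skew_sp lam mu y = 0.
  move=> muB; have [j jB] : exists j : 'I_l, (B < shifted mu j)%N.
    apply/existsP; apply: contraNT muB; rewrite negb_exists => /forallP h.
    by apply: mem_gparts => j; rewrite leqNgt.
  by rewrite (skew_sp_eq0 y slam (size_tuple mu) lamB jB) mulr0.
split.
  apply: sub_finite_set (finite_seq (gparts l B)) => mu /=.
  by apply: contra_notT => /supp.
rewrite -(fsbig_widen [set` gparts l B]) //; last by move=> mu [_ /= /negP/supp].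
rewrite -fsbig_seq ?uniq_gparts //.
have dx : sp_den x != 0 by rewrite xE sp_den_varf.
have dxy : sp_den (x ++ y) != 0 by rewrite xyE sp_den_varf.
have -> : \sum_(mu <- gparts l B) sp mu x * skew_sp lam mu y =
    (\sum_(mu <- gparts l B) sp_num mu x * skew_sp lam mu y) / sp_den x.
  by rewrite mulr_suml; apply: eq_bigr => mu _; rewrite /sp mulrAC.
apply/eqP; rewrite eqr_div //; apply/eqP/esym.
apply: branching_numerators; rewrite ?size_tuple //.
by rewrite xyE varf_notin0.
Qed.
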